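(* Let $(X,K,\|\cdot\|)$ be a real ordered Banach space whose closed cone $K$ is normal and satisfies $\mathrm{int}(K)\neq\varnothing$. Let $A\in L(X)$ be a positive operator such that 1) for each vector $x\in K$, $x\ne 0$, there exists a natural number $n_x$ such that $A^{n_x}(x)\in \mathrm{int}(K)$; 2) for each vector $x\in K$ its trajectory $\{A^n(x)\}_{n\in\mathbb{N}}$ is relatively compact in $X$. Then the sequence $\{A^n\}_{n\ge 0}$ converges pointwise (i.e. in norm at each $x\in X$) to some operator $A_0\in L(X)$. If $A_0$ is not zero, then there exist a vector $u\in\mathrm{int}(K)$ and a functional $f_0\in K'$ such that (i) $A(u)=u$, $A^*(f_0)=f_0$, $f_0(u)=1$, and moreover $f_0(x)>0$ if $x\in K$, $x\ne 0$; (ii) $A_0=f_0\otimes u$; (iii) for each $f\in X'$ one has $(A^* )^n(f)\to A_0^*(f)$ as $n\to+\infty$ with respect to the weak*-topology $\sigma(X',X)$; (iv) $\lambda=1$ is a simple eigenvalue of the operators $A$ and $A^*$.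
   Context: A cone $K$ in a real vector space is a nonempty subset with $\lambda x+\mu y\in K$ for $x,y\in K$, $\lambda,\mu\ge 0$, and such that $x,-x\in K$ implies $x=0$. An ordered Banach space $(X,K,\|\cdot\|)$ is a real Banach space $X$ ordered by a closed cone $K$ ($x\le y$ iff $y-x\in K$). $K$ is normal if there is $\delta>0$ with $\|x+y\|\ge\delta\max\{\|x\|,\|y\|\}$ for all $x,y\in K$. $\mathrm{int}(K)$ is the norm interior of $K$. $X'$ is the dual of $X$ and $K'=\{f\in X': f(x)\ge 0 \text{ for all } x\in K\}$. $L(X)$ is the space of continuous linear operators on $X$; $A\in L(X)$ is positive if $A(K)\subset K$; $A^*$ is its adjoint on $X'$. For $f\in X'$, $u\in X$, $f\otimes u$ is the operator $x\mapsto f(x)u$. An eigenvalue is called simple if its eigenspace is one-dimensional. *)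

(* Defs.v *)
From HB Require Import structures.
From mathcomp Require Import all_boot all_order all_algebra.
From mathcomp Require Import all_classical all_reals all_analysis.

Set Implicit Arguments.
Unset Strict Implicit.
Unset Printing Implicit Defensive.

Import Order.TTheory GRing.Theory Num.Theory.
Import numFieldNormedType.Exports.

Local Open Scope classical_set_scope.
Local Open Scope ring_scope.

(* clinType X Y is the space L(X, Y) of continuous linear maps. The operator norm
   is not formalized, only the vector space structure, obtained below by viewing
   L(X, Y) as a subspace of the space of all maps X -> Y. *)
#[short(type = "clinType")]
HB.structure Definition CLin (R : realType) (X Y : normedModType R) :=
  {f of @GRing.Linear R X Y *:%R f & @Continuous X Y f}.

Section clin_lmodule.
Context {R : realType} {X Y : normedModType R}.

Definition clin : {pred X -> Y} :=
  [pred f : X -> Y | `[< linear f /\ continuous f >]].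

Let clinW (f : clinType X Y) : (f : X -> Y) \in clin.
Proof. by apply/asboolP; split; [exact: linearP | exact: cts_fun]. Qed.

Section Sub.
Context (f : X -> Y) (fP : f \in clin).

Definition clin_sub_fun := f.

Let sub_linear : linear clin_sub_fun. Proof. by case/asboolP: fP. Qed.

Let sub_continuous : continuous clin_sub_fun.
Proof. by case/asboolP: fP. Qed.

HB.instance Definition _ :=
  GRing.isLinear.Build R X Y *:%R clin_sub_fun sub_linear.
HB.instance Definition _ := isContinuous.Build X Y clin_sub_fun sub_continuous.

Definition clin_sub : clinType X Y := clin_sub_fun.
End Sub.

Let clin_rect (P : clinType X Y -> Type) :
  (forall f (fP : f \in clin), P (clin_sub fP)) -> forall g, P g.
Proof.
move=> PS g; have := PS _ (clinW g).
suff -> : clin_sub (clinW g) = g by [].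
suff clinI (f h : clinType X Y) : f = h :> (X -> Y) -> f = h by exact: clinI.
case: f h => f [[f1] [f2] [f3]] [h [[h1] [h2] [h3]]] /= fh; subst h.
by rewrite (Prop_irrelevance f1 h1) (Prop_irrelevance f2 h2)
  (Prop_irrelevance f3 h3).
Qed.

Let clin_subK f (fP : f \in clin) : clin_sub fP = f :> (X -> Y).
Proof. by []. Qed.

HB.instance Definition _ :=
  isSub.Build (X -> Y) (fun f => f \in clin) (clinType X Y) clin_rect clin_subK.
HB.instance Definition _ := [Choice of clinType X Y by <:].

Let clin_submod_closed : submod_closed clin.
Proof.
split.
  apply/asboolP; split; last exact: cst_continuous.
  by move=> a x y; rewrite /= scaler0 addr0.
move=> a f g /asboolP[flin fcont] /asboolP[glin gcont]; apply/asboolP; split.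
  move=> b x y; rewrite !fctE flin glin !scalerDr !scalerA (mulrC a b).
  by rewrite addrACA.
by move=> x; apply: cvgD; [apply: cvgZr; exact: fcont | exact: gcont].
Qed.

HB.instance Definition _ :=
  GRing.isSubmodClosed.Build R (X -> Y) clin clin_submod_closed.
HB.instance Definition _ := [SubChoice_isSubLmodule of clinType X Y by <:].

End clin_lmodule.

Section clin_comp.
Context {R : realType} {X Y Z : normedModType R}.
Context (g : clinType Y Z) (f : clinType X Y).

Let comp_continuous : continuous (g \o f).
Proof. by move=> x; apply: continuous_comp; exact: cts_fun. Qed.

HB.instance Definition _ := isContinuous.Build X Z (g \o f) comp_continuous.

Definition clin_comp : clinType X Z := g \o f.

End clin_comp.

(* The dual X' of X; R^o is the field R seen as a normed space over itself. *)
Notation top_dual X := (clinType X (_^o)).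

Section rank_one.
Context {R : realType} {X : normedModType R}.
Context (f : top_dual X) (u : X).

(* tensor f u is the rank-one operator f \otimes u. *)
Definition tensor_fun (x : X) : X := f x *: u.

Let tensor_linear : linear tensor_fun.
Proof. by move=> a x y; rewrite /tensor_fun linearP scalerDl scalerA. Qed.

Let tensor_continuous : continuous tensor_fun.
Proof. by move=> x; apply: cvgZr_tmp; exact: cts_fun. Qed.

HB.instance Definition _ :=
  GRing.isLinear.Build R X X *:%R tensor_fun tensor_linear.
HB.instance Definition _ := isContinuous.Build X X tensor_fun tensor_continuous.

Definition tensor : clinType X X := tensor_fun.

End rank_one.

Section adjoint.
Context {R : realType} {X : normedModType R}.
Context (A : clinType X X).

Definition adjoint (f : top_dual X) : top_dual X := clin_comp f A.

Let adjoint_linear : linear adjoint.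
Proof. by move=> a f g; exact/val_inj. Qed.

HB.instance Definition _ :=
  GRing.isLinear.Build R (top_dual X) (top_dual X) *:%R adjoint adjoint_linear.

End adjoint.

(* The dual space carrying sigma(X', X): the coarsest topology making all the
   evaluations at points of X continuous. *)
Definition weak_star {R : realType} (X : normedModType R) :=
  initial_topology (fun f : top_dual X => (f : {ptws X -> R})).

Section eigen.
Context {R : realType} {V : lmodType R}.

Definition lin_eigenspace (T : {linear V -> V}) (a : R) : set V :=
  [set v | T v = a *: v].

Definition one_dimensional (E : set V) :=
  exists2 v, v != 0 & E = [set a *: v | a in [set: R]].

(* Simplicity is geometric: it concerns the eigenspace, not the generalized
   eigenspace. *)
Definition simple_eigenvalue (T : {linear V -> V}) (a : R) :=
  one_dimensional (lin_eigenspace T a).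

End eigen.

Section cones.
Context {R : realType}.

Definition cone (V : lmodType R) (K : set V) :=
  [/\ K !=set0,
      (forall (x y : V) (a b : R),
         K x -> K y -> 0 <= a -> 0 <= b -> K (a *: x + b *: y))
    & (forall x : V, K x -> K (- x) -> x = 0)].

Definition normal_cone (X : normedModType R) (K : set X) :=
  exists2 d : R, 0 < d
    & forall x y : X, K x -> K y -> d * Num.max `|x| `|y| <= `|x + y|.

Definition dual_cone (X : normedModType R) (K : set X) : set (top_dual X) :=
  [set f | forall x, K x -> 0 <= f x].

Definition positive_operator (X : normedModType R) (K : set X)
  (A : clinType X X) := A @` K `<=` K.

End cones.

(* Main.v *)
Require Import Defs.
From HB Require Import structures.
From mathcomp Require Import all_boot all_order all_algebra.
From mathcomp Require Import all_classical all_reals all_analysis.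

Set Implicit Arguments.
Unset Strict Implicit.
Unset Printing Implicit Defensive.

Import Order.TTheory GRing.Theory Num.Theory.
Import numFieldNormedType.Exports.

Local Open Scope classical_set_scope.
Local Open Scope ring_scope.

(** Everything rests on one extremal argument in the style of Collatz and
    Wielandt. Let [P] and [Q] be continuous maps commuting with [A]. The
    largest [t] such that [t Q <= P] at some point of an orbit can only grow
    along that orbit, so at a cluster point [w] it has reached its supremum
    [m], and [P w - m Q w] lies in [K]. If this vector were nonzero, a power
    of [A] would push it into the interior of [K], where there is room to
    replace [m] by a larger number, at [w] and then, by continuity, at a point
    of the orbit itself, which contradicts the choice of [m]. Hence
    [P w = m Q w] ([cluster_contact]).

    Cluster points exist because trajectories are relatively compact. Moreover
    an interior point [e] of [K] is an order unit, and the normality of [K]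
    turns order bounds into norm bounds: [|A^n x| <= C |x| |A^n e|]
    ([iter_le_order_unit]). As the orbit of [e] is bounded, the powers of [A]
    are uniformly bounded.

    - If the orbit of [e] comes arbitrarily close to [0], this estimate makes
      all orbits converge to [0], and the limit operator is zero.

    - Otherwise take [P = A], [Q = id] and the orbit of [e]: a cluster point
      [w] satisfies [A w = m w], and [m = 1] because the norms
      [|A^n w| = m^n |w|] stay away from zero and from infinity. Since some
      power of [A] sends [w] into the interior of [K], this gives a fixed
      point [u] in the interior ([fixed_point_interior]). Next take [P = id]
      and [Q] constant equal to [u]: any cluster point of the orbit of a
      vector is a multiple of [u], hence fixed by [A], and since the powers of
      [A] are bounded the whole orbit converges to it ([orbit_cvg_line]).

    So [A^n x] tends to [f0(x) u], and [f0] is linear and continuous as the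
    coefficient of a limit of uniformly bounded linear maps. The remaining
    claims are read off from this limit; for instance [A v = v] gives
    [v = lim A^n v = f0(v) u], and [f A = f] gives
    [f(x) = lim f(A^n x) = f0(x) f(u)]. *)

(** * Preliminaries *)

(** If [m > 1], the powers of [m^-1] would tend to zero while staying above
    [B^-1]. *)
Lemma bounded_expr_le1 (R : realType) (m B : R) :
  (forall n, m ^+ n <= B) -> m <= 1.
Proof.
move=> mB; rewrite leNgt; apply/negP => m1.
have m0 : 0 < m := lt_trans ltr01 m1.
have B0 : 0 < B by rewrite (lt_le_trans _ (mB 0%N)) ?expr0.
have /cvgrPdist_lt/(_ B^-1) : (fun n => m^-1 ^+ n) @ \oo --> (0 : R).
  by apply: cvg_expr; rewrite gtr0_norm ?invr_gt0// invf_lt1.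
rewrite invr_gt0 => /(_ B0) [n _ /(_ n (leqnn n))] /=.
rewrite sub0r normrN ger0_norm ?exprn_ge0 ?invr_ge0 1?ltW//.
by rewrite exprVn ltf_pV2 ?posrE ?exprn_gt0// ltNge mB.
Qed.

Lemma scaler_cvg_unique (R : realType) (X : normedModType R)
    (F : set_system X) (FF : ProperFilter F) (u : X) (a b : R) :
  u != 0 -> F --> a *: u -> F --> b *: u -> a = b.
Proof.
move=> u0 Fa /(norm_cvg_unique Fa)/eqP.
by rewrite -subr_eq0 -scalerBl scaler_eq0 (negbTE u0) orbF subr_eq0 => /eqP.
Qed.

Lemma closed_cluster (X : topologicalType) (C : set X) (f : nat -> X) w :
    closed C ->
    cluster (f @ \oo) w -> (\forall n \near \oo, C (f n)) ->
  C w.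
Proof. by move=> Cc; rewrite clusterE => wf /wf; exact: Cc. Qed.

Lemma interior_perturb (R : realType) (X : normedModType R) (K : set X)
    (g : R -> X) :
    continuous g -> interior K (g 0) ->
  exists2 e : R, 0 < e & K (g e).
Proof.
move=> gc Kg; have /nbhs_normP[e /= e0 eK] : nbhs 0 [set t | K (g t)].
  exact: gc.
exists (e / 2); first by rewrite divr_gt0.
apply: eK => /=; rewrite sub0r normrN gtr0_norm ?divr_gt0//.
by rewrite ltr_pdivrMr// ltr_pMr// ltr1n.
Qed.

Lemma iter_commute (T : Type) (f g : T -> T) n x :
  (forall y, g (f y) = f (g y)) -> g (iter n f x) = iter n f (g x).
Proof. by move=> gf; elim: n => //= n IHn; rewrite gf IHn. Qed.

(** * Iterates of a continuous linear operator *)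

Section orbits.
Context {R : realType} {X : normedModType R} (A : clinType X X).

Lemma iter_linear n a x y :
  iter n A (a *: x + y) = a *: iter n A x + iter n A y.
Proof. by elim: n => //= n ->; rewrite linearP. Qed.

Lemma iterZ n a x : iter n A (a *: x) = a *: iter n A x.
Proof.
have := iter_linear n a x 0; rewrite addr0.
by rewrite (iter_fix n (linear0 A)) addr0.
Qed.

Lemma iterB n x y : iter n A (x - y) = iter n A x - iter n A y.
Proof. by rewrite -scaleN1r addrC iter_linear scaleN1r addrC. Qed.

Lemma iter_continuous n : continuous (iter n A).
Proof.
elim: n => [|n IHn] x; first exact: cvg_id.
by apply: continuous_comp; [exact: IHn | exact: cts_fun].
Qed.

Lemma fixed_orbit_cvg x : A x = x -> iter n A x @[n --> \oo] --> x.
Proof.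
by move=> Ax; under eq_fun do rewrite (iter_fix _ Ax); exact: cvg_cst.
Qed.

End orbits.

(** * Cones, order units and normality *)

Section cones.
Context {R : realType} {X : normedModType R} {K : set X} (K_cone : cone K).

Lemma coneZ a x : 0 <= a -> K x -> K (a *: x).
Proof.
case: K_cone => _ KP _ a0 Kx.
by have := KP x x a 0 Kx Kx a0 (lexx 0); rewrite scale0r addr0.
Qed.

Lemma cone0 : K 0.
Proof. by case: K_cone => -[x Kx] _ _; rewrite -(scale0r x); exact: coneZ. Qed.

(** The scalar form of pointedness: a line through the origin meets [K] in at
    most a half-line. *)
Lemma cone_coef_ge0 a x : K x -> x != 0 -> K (a *: x) -> 0 <= a.
Proof.
move=> Kx x0 Kax; rewrite leNgt; apply/negP => a0; case: K_cone => _ _ Kpt.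
suff /eqP : a *: x = 0 by rewrite scaler_eq0 (lt_eqF a0) (negbTE x0).
by apply: Kpt => //; rewrite -scaleNr; apply: coneZ => //; rewrite oppr_ge0 ltW.
Qed.

(** A ball of radius [r] around [u] lies in [K]; the vector [x], rescaled to
    have norm [r / 2], may therefore be added to [u]. *)
Lemma interior_order_unit u : interior K u ->
  exists2 M : R, 0 < M & forall x, K ((M * `|x|) *: u + x).
Proof.
move=> /nbhs_normP[r /= r0 rK]; exists (2 / r); first by rewrite divr_gt0.
move=> x; have [->|x0] := eqVneq x 0.
  by rewrite normr0 mulr0 scale0r addr0; exact: cone0.
have nx : 0 < `|x| by rewrite normr_gt0.
set M := _ * `|x|; have M0 : 0 < M by rewrite mulr_gt0 ?divr_gt0.
have -> : M *: u + x = M *: (u + M^-1 *: x).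
  by rewrite scalerDr scalerA divff ?scale1r// gt_eqF.
apply: coneZ; first exact: ltW.
apply: rK => /=; rewrite opprD addNKr normrN normrZ normfV (gtr0_norm M0).
rewrite /M invfM -mulrA mulVf ?gt_eqF// mulr1 invf_div.
by rewrite ltr_pdivrMr// ltr_pMr// ltr1n.
Qed.

End cones.

Section normal.
Context {R : realType} {X : normedModType R} {K : set X} {d : R}.
Context (d0 : 0 < d).
Context (Kn : forall x y : X, K x -> K y -> d * Num.max `|x| `|y| <= `|x + y|).

Lemma normal_le x y : K x -> K (y - x) -> `|x| <= d^-1 * `|y|.
Proof.
move=> Kx Kyx; rewrite -ler_pdivrMl ?invr_gt0// invrK.
have := Kn Kx Kyx; rewrite subrKC; apply: le_trans.
by apply: ler_wpM2l; [exact: ltW|rewrite le_max lexx].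
Qed.

(** [x] is the difference of [y + x] and [y], and [y + x] lies in the order
    interval from [0] to [2 y], to which [normal_le] applies. *)
Lemma normal_bound x y : K (y + x) -> K (y - x) -> `|x| <= (2 / d + 1) * `|y|.
Proof.
move=> Kp Km; rewrite -[x in leLHS](addrK y) (le_trans (ler_normB _ _))//.
rewrite mulrDl mul1r lerD2r addrC (le_trans (normal_le Kp (y := 2 *: y) _))//.
  by rewrite scaler_nat mulr2n opprD addrACA subrr add0r.
by rewrite normrZ ger0_norm// mulrA (mulrC d^-1).
Qed.

End normal.

(** * The extremal argument *)

Section positive.
Context {R : realType} {X : normedModType R} {K : set X}.
Context (K_closed : closed K).
Context {A : clinType X X} (A_pos : positive_operator K A).

Lemma positive_iter n x : K x -> K (iter n A x).
Proof.
by move=> Kx; elim: n => //= n IHn; apply: A_pos; exists (iter n A x).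
Qed.

Section contact.
Context (A_int : forall x : X, K x -> x <> 0 ->
  exists n : nat, interior K (iter n A x)).
Context {P Q : X -> X} (P_cont : continuous P) (Q_cont : continuous Q).
Context (PA : forall y, P (A y) = A (P y)) (QA : forall y, Q (A y) = A (Q y)).

(** Membership in [S] persists along the orbit, so [P w - sup S Q w] lies in
    [K]; if it were nonzero, its orbit would enter the interior of [K], and a
    number larger than [sup S] would belong to [S]. The choices [P = A] and
    [Q = id] yield an eigenvector, [P = id] and a constant [Q] the limit of an
    orbit. *)
Lemma cluster_contact x w :
    let S := [set t : R | exists n, K (P (iter n A x) - t *: Q (iter n A x))] in
    has_sup S -> cluster (iter n A x @[n --> \oo]) w ->
  P w = sup S *: Q w.
Proof.
move=> S [S0 Sub] wx; pose D t y := P y - t *: Q y.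
have Dy_cont t : continuous (D t).
  by move=> y; apply: cvgB; [exact: P_cont | apply: cvgZr; exact: Q_cont].
have Dt_cont y : continuous (D^~ y).
  by move=> t; apply: cvgB; [exact: cvg_cst | apply: cvgZr_tmp; exact: cvg_id].
have D_iter n t y : D t (iter n A y) = iter n A (D t y).
  by rewrite /D (iter_commute _ _ PA) (iter_commute _ _ QA) -iterZ -iterB.
have KS t : S t -> K (D t w).
  (* positivity of A propagates the membership along the rest of the orbit *)
  move=> [n Kn]; apply: (closed_cluster (C := D t @^-1` K) _ wx).
    by apply: closed_comp => // y _; exact: Dy_cont.
  exists n => // p /= np; rewrite -(subnK np) iterD D_iter.
  exact: positive_iter.
have Ksup : K (D (sup S) w).
  have cl : closed (D^~ w @^-1` K).
    by apply: closed_comp => // t _; exact: Dt_cont.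
  by apply: cl; apply: closureS (closure_sup S0 Sub).
apply/eqP; rewrite -subr_eq0; apply/eqP; apply: contrapT => nz.
have [N] := A_int Ksup nz; rewrite -D_iter => iK.
(* room in the interior: first enlarge sup S, then move from w to the orbit *)
have [e e0 Ke] : exists2 e : R, 0 < e & interior K (D (sup S + e) (iter N A w)).
  apply: (interior_perturb (g := fun e => D (sup S + e) (iter N A w))).
    move=> e; apply: cvgB; [exact: cvg_cst | apply: cvgZr_tmp].
    by apply: cvgD; [exact: cvg_cst | exact: cvg_id].
  by rewrite addr0; have /interior_id -> := open_interior K.
have wU : nbhs w [set y | K (D (sup S + e) (iter N A y))].
  suff : {for w, continuous (D (sup S + e) \o iter N A)} by apply.
  by apply: continuous_comp; [exact: iter_continuous | exact: Dy_cont].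
have [|_ [[n _ <-] Kn]] := wx (range (fun n => iter n A x)) _ _ wU.
  by exists 0%N => // n _; exists n.
have : sup S + e <= sup S.
  by apply: ub_le_sup => //; exists (N + n)%N; rewrite iterD.
by rewrite gerDl leNgt e0.
Qed.

End contact.

End positive.

(** * Power boundedness, fixed points and convergence of orbits *)

Section convergence.
Context {R : realType} {X : normedModType R} {K : set X}.
Context (K_cone : cone K) (K_closed : closed K) (K_normal : normal_cone K).
Context {A : clinType X X} (A_pos : positive_operator K A).
Context (A_int : forall x : X, K x -> x <> 0 ->
  exists n : nat, interior K (iter n A x)).
Context (A_traj : forall x : X, K x ->
  precompact [set iter n A x | n in [set: nat]]).

Lemma orbit_cluster x : K x -> exists w, cluster (iter n A x @[n --> \oo]) w.
Proof.
move=> /A_traj[C AC [C_compact _]].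
have [|w [_ wx]] := C_compact (iter n A x @[n --> \oo]) _; last by exists w.
by exists 0%N => // n _; apply: AC; exists n.
Qed.

(** If [x] lies between [-c e] and [c e], then [A^n x] lies between
    [-c (A^n e)] and [c (A^n e)], and normality bounds the norm on such an order
    interval. *)
Lemma iter_le_order_unit e : interior K e ->
  exists2 C : R, 0 < C & forall n x, `|iter n A x| <= C * `|x| * `|iter n A e|.
Proof.
move=> /(interior_order_unit K_cone)[M M0 eM]; have [d d0 Kd] := K_normal.
exists ((2 / d + 1) * M) => [|n x].
  by rewrite mulr_gt0// addr_gt0// divr_gt0.
set c := M * `|x|; have c0 : 0 <= c by rewrite mulr_ge0// ltW.
have Ke y : `|y| = `|x| -> K (c *: iter n A e + iter n A y).
  by move=> yx; rewrite -iter_linear /c -yx; exact: positive_iter.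
have /(normal_bound d0 Kd) : K (c *: iter n A e + iter n A x) by exact: Ke.
have -> : (2 / d + 1) * M * `|x| * `|iter n A e| =
    (2 / d + 1) * `|c *: iter n A e|.
  by rewrite normrZ (ger0_norm c0) /c !mulrA.
apply; rewrite -scaleN1r -(iterZ A n (-1)) scaleN1r.
by apply: Ke; rewrite normrN.
Qed.

Lemma power_bounded : interior K !=set0 ->
  exists2 B : R, 0 < B & forall n x, `|iter n A x| <= B * `|x|.
Proof.
move=> [e ie]; have [C C0 AC] := iter_le_order_unit ie.
have [W eW [/compact_bounded/pinfty_ex_gt0[M M0 WM] _]] :=
  A_traj (interior_subset ie).
exists (C * M) => [|n x]; first exact: mulr_gt0.
rewrite (le_trans (AC n x))// -!mulrA ler_pM2l// (mulrC M) ler_wpM2l//.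
by apply: WM; apply: eW; exists n.
Qed.

(** Once the orbit is close to the fixed point [w] it stays close, because the
    powers of [A] expand distances to [w] by a factor of at most [B]. *)
Lemma cvg_to_fixed_cluster B x w : 0 < B ->
    (forall n x, `|iter n A x| <= B * `|x|) -> A w = w ->
    cluster (iter n A x @[n --> \oo]) w ->
  iter n A x @[n --> \oo] --> w.
Proof.
move=> B0 AB Aw wx; apply/cvgrPdist_le => e e0.
have wU : nbhs w (ball w (e / B)) by apply: nbhsx_ballx; rewrite divr_gt0.
have [|_ [[N _ <-] wN]] := wx (range (fun n => iter n A x)) _ _ wU.
  by exists 0%N => // n _; exists n.
exists N => // n /= Nn.
rewrite -(subnK Nn) iterD -{1}(iter_fix (n - N) Aw) -iterB.
rewrite (le_trans (AB _ _))//.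
by rewrite -ler_pdivlMl// mulrC; move: wN; rewrite -ball_normE => /ltW.
Qed.

(** Splitting [A^n e] as [A^(n - N)] applied to a small [A^N e] shows that the
    whole orbit of [e] tends to [0], and [iter_le_order_unit] carries this over
    to the orbit of [x]. *)
Lemma orbits_vanish e : interior K e ->
    (forall c : R, 0 < c -> exists n, `|iter n A e| < c) ->
  forall x, iter n A x @[n --> \oo] --> 0.
Proof.
move=> ie e_small x; have [C C0 AC] := iter_le_order_unit ie.
have [|B B0 AB] := power_bounded; first by exists e.
apply/cvgrPdist_le => r r0.
have D0 : 0 < C * (`|x| + 1) * B by rewrite !mulr_gt0// ltr_wpDl.
have [|N eN] := e_small (r / (C * (`|x| + 1) * B)); first by rewrite divr_gt0.
exists N => // n /= Nn; rewrite sub0r normrN (le_trans (AC n x))//.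
rewrite -(subnK Nn) iterD.
rewrite (@le_trans _ _ (C * (`|x| + 1) * (B * `|iter N A e|)))//.
  apply: ler_pM => //; first exact/mulr_ge0/normr_ge0/ltW.
  by rewrite ler_pM2l// lerDl.
by rewrite mulrA -ler_pdivlMl// mulrC ltW.
Qed.

(** The fixed point is a cluster point of the orbit of [e], obtained from
    [cluster_contact] with [P = A] and [Q = id]. The lower bound on the orbit
    makes it nonzero and excludes an eigenvalue below [1]. *)
Lemma fixed_point_interior e : interior K e ->
    (exists2 c : R, 0 < c & forall n, c <= `|iter n A e|) ->
  exists u, [/\ interior K u, u != 0 & A u = u].
Proof.
move=> ie [c c0 ce]; have Ke := interior_subset ie.
have [d d0 Kd] := K_normal.
have [|B B0 AB] := power_bounded; first by exists e.
have [w we] := orbit_cluster Ke.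
have Kw : K w.
  apply: (closed_cluster K_closed we).
  by exists 0%N => // n _; exact: positive_iter.
have cw n : c <= `|iter n A w|.
  apply: (closed_cluster (C := [set y | c <= `|iter n A y|]) _ we).
    apply: (closed_comp (f := fun y => `|iter n A y|) (D := [set r | c <= r])).
      by move=> y _; apply: cvg_norm; exact: iter_continuous.
    exact: closed_ge.
  by exists 0%N => // m _ /=; rewrite -iterD.
have w0 : w != 0 by rewrite -normr_gt0 (lt_le_trans c0)// (cw 0%N).
have := cluster_contact K_closed A_pos A_int (P := A) (Q := id) _ _ _ _ _ we.
set S := [set t | _]; set m := sup S => /= Aw.
have {}Aw : A w = m *: w.
  apply: Aw => //; [exact: cts_fun | by move=> y; exact: cvg_id |].
  split.
    exists 0; exists 0%N; rewrite scale0r subr0.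
    exact: (positive_iter A_pos 1).
  (* a bound on S: t |A^n e| <= d^-1 |A^(n+1) e| by normality *)
  exists (B / d) => t [n Kn]; have [/le_trans->//|t0] := leP t 0.
    by rewrite ltW// divr_gt0.
  have ne0 : 0 < `|iter n A e| by exact: lt_le_trans (ce n).
  rewrite -(ler_pM2r ne0) -[t in leLHS]gtr0_norm// -normrZ.
  have /(le_trans (normal_le d0 Kd _ Kn)) -> // :
     d^-1 * `|A (iter n A e)| <= B / d * `|iter n A e|.
    by rewrite (mulrC B) -mulrA ler_pM2l ?invr_gt0// (AB 1%N).
  by apply: coneZ => //; [exact: ltW | exact: positive_iter].
have m_ge0 : 0 <= m.
  apply: (cone_coef_ge0 K_cone Kw w0); rewrite -Aw.
  exact: (positive_iter A_pos 1).
have An n : iter n A w = m ^+ n *: w.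
  elim: n => [|n IHn]; rewrite ?expr0 ?scale1r//=.
  by rewrite IHn linearZ/= Aw scalerA exprSr.
have nw : 0 < `|w| by rewrite normr_gt0.
have Anorm n : `|iter n A w| = m ^+ n * `|w|.
  by rewrite An normrZ ger0_norm// exprn_ge0.
have m_gt0 : 0 < m.
  rewrite lt_neqAle m_ge0 andbT; apply/eqP => m0.
  by have := cw 1%N; rewrite Anorm -m0 expr1 mul0r leNgt c0.
have m1 : m = 1.
  apply/eqP; rewrite eq_le; apply/andP; split.
    by apply: (bounded_expr_le1 (B := B)) => n; rewrite -(ler_pM2r nw) -Anorm.
  rewrite -invf_le1//; apply: (bounded_expr_le1 (B := `|w| / c)) => n.
  by rewrite exprVn ler_pdivlMr// mulrC ler_pdivrMr ?exprn_gt0// mulrC -Anorm.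
have {}Aw : A w = w by rewrite Aw m1 scale1r.
exists w; split => //; have [|n] := A_int Kw; first exact/eqP.
by rewrite (iter_fix n Aw).
Qed.

(** Only the orbits of vectors of [K] are known to be relatively compact, so [x]
    is first translated into [K] by a multiple of [u], which [A] does not
    move. *)
Lemma orbit_cvg_line u x : interior K u -> u != 0 -> A u = u ->
  exists t : R, iter n A x @[n --> \oo] --> t *: u.
Proof.
move=> iu u0 Au; have [d d0 Kd] := K_normal.
have [|B B0 AB] := power_bounded; first by exists u.
have [M M0 uM] := interior_order_unit K_cone iu.
have nu : 0 < `|u| by rewrite normr_gt0.
have Ku := interior_subset iu.
have [t xt] : exists t : R,
    iter n A ((M * `|x|) *: u + x) @[n --> \oo] --> t *: u.
  set y := _ + x; have Ky : K y by exact: uM.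
  have [w wy] := orbit_cluster Ky.
  have := cluster_contact K_closed A_pos A_int
    (P := id) (Q := fun=> u) _ _ _ _ _ wy.
  set S := [set t | _]; set m := sup S => /= wE.
  exists m; apply: (cvg_to_fixed_cluster B0 AB); first by rewrite linearZ/= Au.
  rewrite -wE//; [by move=> z; exact: cvg_id | exact: cst_continuous |].
  split.
    exists (- (M * `|y|)); exists 0%N; rewrite scaleNr opprK addrC; exact: uM.
  exists (d^-1 * (B * `|y|) / `|u|) => t [n Kn]; have [t0|t0] := leP t 0.
    by rewrite (le_trans t0)// divr_ge0// mulr_ge0 ?invr_ge0 ?mulr_ge0// ltW.
  rewrite ler_pdivlMr// -[t in leLHS]gtr0_norm// -normrZ.
  rewrite (le_trans (normal_le d0 Kd _ Kn))//; last first.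
    by rewrite ler_pM2l ?invr_gt0.
  by apply: coneZ => //; exact: ltW.
exists (t - M * `|x|); rewrite scalerBl.
have -> : (fun n => iter n A x) =
    (fun n => iter n A ((M * `|x|) *: u + x) - (M * `|x|) *: u).
  by apply/funext => n; rewrite iter_linear (iter_fix n Au) addrC addKr.
by apply: cvgB => //; exact: cvg_cst.
Qed.

End convergence.

(** * The limit functional and the weak-star topology *)

(** Since [u] is nonzero the coefficient of a limit is unique, which makes [f]
    linear; the uniform bound on the powers passes to the limit and makes it
    continuous. *)
Lemma limit_functional (R : realType) (X : normedModType R) (A : clinType X X)
    (u : X) (B : R) : u != 0 -> 0 < B ->
    (forall n x, `|iter n A x| <= B * `|x|) ->
    (forall x, exists t : R, iter n A x @[n --> \oo] --> t *: u) ->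
  exists f : top_dual X, forall x, iter n A x @[n --> \oo] --> f x *: u.
Proof.
move=> u0 B0 AB /choice[f fE].
have nu : 0 < `|u| by rewrite normr_gt0.
have f_unique x t : iter n A x @[n --> \oo] --> t *: u -> f x = t.
  exact: scaler_cvg_unique u0 (fE x).
have f_lin : linear (f : X -> R^o).
  move=> a x y; apply: f_unique; under eq_fun do rewrite iter_linear.
  rewrite scalerDl -scalerA; apply: cvgD; last exact: fE.
  by apply: cvgZr; exact: fE.
pose flin := GRing.isLinear.Build R X R^o *:%R f f_lin.
pose F : {linear X -> R^o} := HB.pack f flin.
have fcont : continuous (f : X -> R^o).
  apply: (bounded_linear_continuous (f := F)); apply/bounded_funP => r.
  exists (B * r / `|u|) => x xr; rewrite ler_pdivlMr// -normrZ.
  apply: (closed_cvg (fun y : X => `|y| <= B * r) _ _ _ (fE x)).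
    apply: (closed_comp (f := fun y : X => `|y|) (D := [set t | t <= B * r])).
      by move=> y _; exact: norm_continuous.
    exact: closed_le.
  by exists 0%N => // n _ /=; rewrite (le_trans (AB n x))// ler_pM2l.
have fP : (f : X -> R^o) \in clin by apply/asboolP.
by exists (clin_sub fP).
Qed.

(** The weak-star topology is initial for the inclusion into the pointwise
    topology, so its neighbourhoods are preimages of pointwise ones. *)
Lemma weak_star_cvg (R : realType) (X : normedModType R) (T : Type)
    (F : set_system T) (g : T -> top_dual X) (l : top_dual X) :
    Filter F -> (forall x, g t x @[t --> F] --> l x) ->
  (g : T -> weak_star X) @ F --> (l : weak_star X).
Proof.
move=> FF gl U [? [[B oB <-] Bl /filterS]]; apply.
have /pointwise_cvgP : forall x, (fun h : X -> R => h x) @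
    ((fun t => g t : X -> R) @ F) --> (l x : R) by exact: gl.
by apply; exact: open_nbhs_nbhs.
Qed.

Theorem theorem5 (R : realType) (X : completeNormedModType R) (K : set X)
    (K_cone : cone K) (K_closed : closed K) (K_normal : normal_cone K)
    (K_solid : interior K !=set0)
    (A : clinType X X) (A_positive : positive_operator K A)
    (A_interior : forall x : X, K x -> x <> 0 ->
       exists n : nat, interior K (iter n A x))
    (A_trajectory : forall x : X, K x ->
       precompact [set iter n A x | n in [set: nat]]) :
  exists A0 : clinType X X,
    (forall x : X, (fun n : nat => iter n A x) @ \oo --> A0 x) /\
    (A0 <> 0 ->
     exists (u : X) (f0 : top_dual X),
       [/\ interior K u,
           dual_cone K f0,
           [/\ A u = u, adjoint A f0 = f0, f0 u = 1
             & forall x : X, K x -> x <> 0 -> 0 < f0 x],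
           A0 = tensor f0 u
         & (forall f : top_dual X,
              (fun n : nat => iter n (adjoint A) f : weak_star X) @ \oo -->
                (adjoint A0 f : weak_star X)) /\
           (simple_eigenvalue A 1 /\ simple_eigenvalue (adjoint A) 1)]).
Proof.
have [e ie] := K_solid.
have [B B0 AB] := power_bounded K_cone K_normal A_positive A_trajectory K_solid.
have [[c c0 ce]|/forall2NP e_small] :=
    pselect (exists2 c : R, 0 < c & forall n, c <= `|iter n A e|); last first.
  exists 0; split=> // x.
  apply: (orbits_vanish K_cone K_normal A_positive A_trajectory ie) => r r0.
  have [//|/existsNP[n /negP]] := e_small r; rewrite -ltNge => ?.
  by exists n.
have [u [iu u0 Au]] : exists u, [/\ interior K u, u != 0 & A u = u].
  by apply: (fixed_point_interior K_cone K_closed K_normal A_positive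
    A_interior A_trajectory ie); exists c.
have Ku := interior_subset iu.
have [f0 f0E] : exists f : top_dual X,
    forall x, iter n A x @[n --> \oo] --> f x *: u.
  apply: (limit_functional u0 B0 AB) => x.
  exact: (orbit_cvg_line K_cone K_closed K_normal A_positive
    A_interior A_trajectory).
have f0_unique x t : iter n A x @[n --> \oo] --> t *: u -> f0 x = t.
  exact: scaler_cvg_unique u0 (f0E x).
have f0Z t : f0 (t *: u) = t.
  by apply: f0_unique; apply: fixed_orbit_cvg; rewrite linearZ/= Au.
have f0u : f0 u = 1 by rewrite -(f0Z 1) scale1r.
have f0A x : f0 (A x) = f0 x.
  apply: f0_unique; under eq_fun do rewrite -iterSr.
  by have := f0E x; rewrite -(cvg_shiftS (fun n => iter n A x)).
have f0_pos x : K x -> x <> 0 -> 0 < f0 x.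
  move=> Kx x0; have [N iN] := A_interior x Kx x0.
  have [r r0 Kr] : exists2 r : R, 0 < r & K (iter N A x - r *: u).
    apply: (interior_perturb (g := fun r => iter N A x - r *: u)); last first.
      by rewrite scale0r subr0.
    by move=> r; apply: cvgB; [exact: cvg_cst | exact: cvgZr_tmp].
  (* the orbit of A^N x - r u stays in K and tends to (f0 x - r) u *)
  apply: (lt_le_trans r0); rewrite -subr_ge0.
  apply: (cone_coef_ge0 K_cone Ku u0).
  have -> : f0 x = f0 (iter N A x) by elim: (N) => //= n ->; rewrite f0A.
  have cvg_shifted : iter n A (iter N A x - r *: u) @[n --> \oo] -->
      (f0 (iter N A x) - r) *: u.
    by have := f0E (iter N A x - r *: u); rewrite linearB/= f0Z.
  apply: (closed_cvg K K_closed _ _ cvg_shifted).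
  by exists 0%N => // n _; exact: positive_iter.
have f0K : dual_cone K f0.
  move=> x Kx; have [->|/eqP x0] := eqVneq x 0; first by rewrite linear0.
  by rewrite ltW// f0_pos.
have adj_f0 : adjoint A f0 = f0 by apply/val_inj/funext => x; exact: f0A.
exists (tensor f0 u); split=> // _; exists u, f0; split => //.
split.
  move=> f; apply: weak_star_cvg => x.
  have -> : (fun n => iter n (adjoint A) f x) = f \o (fun n => iter n A x).
    apply/funext => n; by elim: n x => //= n IHn x; rewrite IHn -iterSr.
  by apply: continuous_cvg; [exact: cts_fun | exact: f0E].
split.
  exists u => //; apply/seteqP; split=> [v /= Av|_ [a _ <-]].
    exists (f0 v) => //; apply: (norm_cvg_unique (f0E v)).
    by apply: fixed_orbit_cvg; rewrite Av scale1r.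
  by rewrite /lin_eigenspace/= linearZ/= Au scale1r.
exists f0.
  apply/eqP => /(congr1 (fun g : top_dual X => g u)).
  by rewrite f0u => /eqP; rewrite oner_eq0.
apply/seteqP; split=> [f /= Af|_ [a _ <-]].
  exists (f u) => //; apply/val_inj/funext => x /=.
  have fA y : f (A y) = f y.
    by have := congr1 (fun g : top_dual X => g y) Af; rewrite scale1r.
  have : f (iter n A x) @[n --> \oo] --> f (f0 x *: u).
    by apply: continuous_cvg; [exact: cts_fun | exact: f0E].
  have -> : (fun n => f (iter n A x)) = cst (f x).
    by apply/funext => n; elim: n => //= n <-; rewrite fA.
  move=> /(norm_cvg_unique (cvg_cst _)).
  by rewrite linearZ/= => ->; exact: mulrC.
by rewrite /lin_eigenspace/= linearZ/= adj_f0 scale1r.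
Qed.
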